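(* Let $p$ be an odd prime. Then the dihedral group $D_p$ of order $2p$ is a Černý group.
   Context: For a finite set $X$, $T_X$ is the set of all maps $X\to X$, acting on the right of $X$. An automaton with state set $X$ is a subset $\Sigma\subseteq T_X$, written $(X,\Sigma)$. The free monoid $\Sigma^*$ acts on the right of $X$ via the homomorphism $\Sigma^*\to T_X$ extending the inclusion $\Sigma\hookrightarrow T_X$. A word $w\in\Sigma^*$ is synchronizing if $|Xw|=1$; the automaton is synchronizing if it admits a synchronizing word. If $G$ is a finite group with generating set $\Delta$, elements of $\Delta$ are identified with the right translations $g\mapsto gd$ of $G$, so $\Delta\subseteq T_G$; the automaton $(G,\Delta)$ is the Cayley graph of $G$ with respect to $\Delta$. With $n=|G|$, $(G,\Delta)$ is a Černý Cayley graph if every synchronizing automaton $(G,\Sigma)$ with $\Delta\subseteq\Sigma\subseteq T_G$ admits a synchronizing word of length at most $(n-1)^2$. The group $G$ is a Černý group if $(G,\Delta)$ is a Černý Cayley graph for every generating set $\Delta$ of $G$. *)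

(* Defs.v *)
From mathcomp Require Import all_boot all_fingroup all_solvable.
Set Implicit Arguments.
Unset Strict Implicit.
Unset Printing Implicit Defensive.

Section Automata.
Variable X : finType.
Implicit Types (Sigma : {set {ffun X -> X}}) (w : seq {ffun X -> X}).

(* Right action: the letters of w are applied from left to right. *)
Definition word_act (x : X) w : X := foldl (fun y (s : {ffun X -> X}) => s y) x w.

Definition word_over Sigma w : bool := all (fun s => s \in Sigma) w.

Definition synchronizing_word Sigma w : Prop :=
  word_over Sigma w /\ #|[set word_act x w | x : X]| = 1.

Definition synchronizing Sigma : Prop := exists w, synchronizing_word Sigma w.

End Automata.

Section Cerny.
Variable gT : finGroupType.
Implicit Type Delta : {set gT}.

Definition right_translation (d : gT) : {ffun gT -> gT} :=
  [ffun g => (g * d)%g].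

Definition cayley_graph Delta : {set {ffun gT -> gT}} :=
  [set right_translation d | d in Delta].

Definition cerny_cayley_graph Delta : Prop :=
  forall Sigma : {set {ffun gT -> gT}},
    cayley_graph Delta \subset Sigma -> synchronizing Sigma ->
    exists2 w, synchronizing_word Sigma w & size w <= (#|gT| - 1) ^ 2.

End Cerny.

(* The group is the whole type gT, so that its underlying set is the state
   set of the automata. *)
Definition cerny_group (gT : finGroupType) : Prop :=
  forall Delta : {set gT},
    (<<Delta>> = [set: gT])%g -> cerny_cayley_graph Delta.

(* Main.v *)
Require Import Defs.
From HB Require Import structures.
From mathcomp Require Import all_boot all_fingroup all_solvable.
From mathcomp Require Import all_order all_algebra all_field zify.

(** Let n = 2p be the order of the group.  A synchronizing automaton has a
    letter s with a fibre of at least two states.  If every set S of states,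
    other than the empty and the full one, has a word w of length at most n
    with |S w^-1| > |S|, then pulling that fibre back at most n - 2 times
    reaches the full set, and reading the letter s last gives a reset word of
    length at most n (n - 2) + 1 = (n - 1)^2 ([short_reset_word]).

    To find the words w, let words act on rational functions on the states by
    f |-> (x |-> f (x w)), and let gamma be n 1_S - |S|, a function of total 0.
    Then |S w^-1| > |S| means that the pullback of gamma along w has positive
    total.  Two facts are combined in [extension_by_averaging].
    - Dimension growth: a subspace U containing gamma can be moved out of the
      hyperplane of functions of total 0 by some word of length at most
      n - dim U, because the span of the images of U grows until this happens
      ([pullback_escape]).
    - Averaging: if U is spanned by translates of gamma whose sum is 0, then
      the totals of their pullbacks along that word also sum to 0 and are not
      all 0, so one of them is positive.
    So it suffices to have translates of gamma, gamma among them, with sum 0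
    and reachable by words no longer than the dimension of their span.

    Let C be the subgroup of rotations, of order p.  In [dihedral_extension]
    there are three cases.
    - gamma is fixed by C: then gamma and its translate by a generator outside
      C have sum 0, the word has length 1 and the dimension is at least 1.
    - The C-translates of gamma have sum 0: their span has dimension at least
      p - 1, because the cyclotomic polynomial 1 + X + ... + X^(p-1) is
      irreducible over the rationals ([free_iter_prime_order]), and every
      rotation is a product of at most p - 1 generators
      ([rotation_product_le]).
    - Otherwise the C-translates span a space of dimension p; all translates
      have sum 0, and every group element is a product of at most p generators
      ([product_le_full]). *)

Set Implicit Arguments.
Unset Strict Implicit.
Unset Printing Implicit Defensive.

Import Order.TTheory GRing.Theory Num.Theory.

(** * Orbits of a linear map of prime order over the rationals *)

Section Prime.
Local Open Scope ring_scope.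

(** This is the p-th cyclotomic polynomial.  It shares its degree and a root
    with the minimal polynomial of a primitive p-th root of unity. *)
Lemma irreducible_prime_geometric (p : nat) :
  prime p -> irreducible_poly (\poly_(i < p) 1 : {poly rat}).
Proof.
move=> p_pr; set Phi := \poly_(i < p) _.
have p_gt0 := prime_gt0 p_pr.
have szPhi : size Phi = p by rewrite size_poly_eq ?oner_eq0.
have [z prim_z] := C_prim_root_exists p_gt0.
have [m [Dm _ rootm]] := minCpolyP z.
have szm : size m = p.
  rewrite -(size_map_poly (ratr : rat -> algC)) -Dm (minCpoly_cyclotomic prim_z).
  by rewrite size_cyclotomic totient_prime // prednK.
have z1 : z - 1 != 0.
  rewrite subr_eq0 -[z]expr1 -(expr0 z) (eq_prim_root_expr prim_z).
  by rewrite mod0n modn_small ?prime_gt1.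
have rootPhi : root (map_poly ratr Phi) z.
  rewrite /root -(inj_eq (mulfI z1)) mulr0.
  have -> : (map_poly ratr Phi).[z] = \sum_(i < p) z ^+ i.
    rewrite (@horner_coef_wide _ p) ?size_map_poly ?szPhi //.
    apply: eq_bigr => i _; rewrite coef_map coef_poly ltn_ord.
    by rewrite /= (ratr_nat _ 1) mul1r.
  by rewrite -subrX1 (prim_expr_order prim_z) subrr.
have Phi0 : Phi != 0 by rewrite -size_poly_gt0 szPhi.
(* In a factorization q' * q the root z belongs to one factor, which then has
   full degree. *)
split=> [|q q1 /dvdpP[q' Dq]]; first by rewrite szPhi prime_gt1.
have := Phi0; rewrite {1}Dq mulf_eq0 negb_or => /andP[q'0 q0].
have szq : (size q' + size q = p.+1)%N.
  rewrite -szPhi Dq size_mul // prednK //.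
  by rewrite addn_gt0 !size_poly_gt0 q0 orbT.
rewrite -dvdp_size_eqp ?Dq ?dvdp_mull // -Dq szPhi.
have := rootPhi; rewrite Dq rmorphM rootM !rootm => /orP[] /dvdp_leq.
  move=> /(_ q'0); rewrite szm => le_p; move: q1 szq.
  case: (size q) (size_poly_gt0 q) => [|[|k]]; rewrite ?q0 // => _ _ /eqP.
  by rewrite !addnS eqSS => /eqP sz; rewrite -sz ltnNge leq_addr in le_p.
move=> /(_ q0); rewrite szm => le_p; move: szq.
case: (size q') (size_poly_gt0 q') => [|k]; rewrite ?q'0 // => _.
by move=> [sz]; rewrite eqn_leq le_p -sz leq_addl.
Qed.

Section PolyAct.
Variables (V : vectType rat) (T : 'End(V)).
Implicit Types (P Q : {poly rat}) (v : V).

Definition poly_act P v : V := \sum_(i < size P) P`_i *: iter i T v.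

Lemma poly_act_wide n P v :
  (size P <= n)%N -> poly_act P v = \sum_(i < n) P`_i *: iter i T v.
Proof.
move=> szP; rewrite /poly_act (big_ord_widen _ (fun i => P`_i *: iter i T v) szP).
rewrite big_mkcond; apply: eq_bigr => i _.
by case: ltnP => // /(nth_default 0)->; rewrite scale0r.
Qed.

Lemma poly_actD P Q v : poly_act (P + Q) v = poly_act P v + poly_act Q v.
Proof.
pose n := maxn (size P) (size Q).
rewrite !(@poly_act_wide n) ?leq_maxl ?leq_maxr //; last exact: size_polyD.
by rewrite -big_split; apply: eq_bigr => i _; rewrite coefD scalerDl.
Qed.

Lemma poly_actC c v : poly_act c%:P v = c *: v.
Proof. by rewrite (@poly_act_wide 1) ?size_polyC_leq1 // big_ord1 coefC. Qed.

Lemma poly_actMX P v : poly_act (P * 'X) v = T (poly_act P v).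
Proof.
have szPX : (size (P * 'X)%R <= (size P).+1)%N.
  by have [->|/size_mulX->//] := eqVneq P 0; rewrite mul0r size_poly0.
rewrite (poly_act_wide v szPX) big_ord_recl coefMX scale0r add0r linear_sum.
by apply: eq_bigr => i _; rewrite coefMX linearZ.
Qed.

Lemma poly_actM P Q v : poly_act (P * Q) v = poly_act P (poly_act Q v).
Proof.
elim/poly_ind: P => [|P c IHP].
  by rewrite mul0r -polyC0 !poly_actC !scale0r.
rewrite mulrDl -mulrAC !poly_actD !poly_actMX IHP; congr (_ + _).
rewrite poly_actC mul_polyC; rewrite !(@poly_act_wide (size Q)) ?size_scale_leq //.
by rewrite scaler_sumr; apply: eq_bigr => i _; rewrite coefZ scalerA.
Qed.

Lemma poly_act_comm P v : T (poly_act P v) = poly_act P (T v).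
Proof.
rewrite linear_sum; apply: eq_bigr => i _.
by rewrite linearZ -iterS iterSr.
Qed.

(** A polynomial P in T of degree less than p that kills v is either coprime to
    Phi = 1 + X + ... + X^(p-1) or a multiple of it.  In the coprime case a
    Bezout relation expresses v through Phi(T) v, which T fixes, so T fixes v.
    The other case occurs only for m = p, and then Phi(T) v = 0. *)
Lemma free_iter_prime_order p v m :
    prime p -> iter p T v = v -> T v != v -> (m <= p)%N ->
    (m = p -> \sum_(i < p) iter i T v != 0) ->
  free [tuple iter i T v | i < m].
Proof.
move=> p_pr Tp Tv lemp nz; pose Phi : {poly rat} := \poly_(i < p) 1.
have szPhi : size Phi = p by rewrite size_poly_eq ?oner_eq0.
have actPhi : poly_act Phi v = \sum_(i < p) iter i T v.
  by rewrite /poly_act szPhi; apply: eq_bigr => i _; rewrite coef_poly ltn_ord scale1r.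
have fixPhi : T (poly_act Phi v) = poly_act Phi v.
  rewrite actPhi linear_sum -(prednK (prime_gt0 p_pr)) big_ord_recr big_ord_recl addrC /=.
  by rewrite -iterS prednK ?prime_gt0 // Tp.
apply/freeP=> k k0; pose P := rVpoly (\row_i k i).
have szP : (size P <= m)%N by apply: size_poly.
have actP : poly_act P v = 0.
  rewrite -[RHS]k0 (poly_act_wide _ szP); apply: eq_bigr => i _.
  by rewrite coef_rVpoly_ord mxE -tnth_nth tnth_mktuple.
suff P0 : P = 0.
  by move=> i; have := coef_rVpoly_ord (\row_i k i) i; rewrite -/P P0 coef0 mxE.
apply/eqP; apply: contraTT isT => P0.
have [] := boolP (Phi %| P) => [dvd|].
  have szPp : size P = p.
    by apply/eqP; rewrite eqn_leq (leq_trans szP) //= -szPhi dvdp_leq.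
  have /eqpP[[a b] /= /andP[a0 b0] ab] : Phi %= P by rewrite -dvdp_size_eqp // szPhi szPp.
  have mp : m = p by apply/eqP; rewrite eqn_leq lemp -szPp.
  have := congr1 (poly_act^~ v) ab; rewrite -!mul_polyC !poly_actM !poly_actC.
  by rewrite actP scaler0 actPhi => /eqP; rewrite scaler_eq0 (negPf a0) (negPf (nz mp)).
rewrite -(irreducible_poly_coprime _ (irreducible_prime_geometric p_pr)).
case/Bezout_coprimepP=> -[u1 u2] /=; rewrite -size_poly_eq1 => /size_poly1P[c c0 Bez].
have := congr1 (poly_act^~ v) Bez.
rewrite poly_actD !poly_actM poly_actC.
have -> : poly_act u2 (poly_act P v) = 0.
  rewrite actP /poly_act big1 // => i _; suff -> : iter i T 0 = 0 by rewrite scaler0.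
  by elim: (val i) => //= n ->; rewrite raddf0.
rewrite addr0 => cv; case/negP: Tv; rewrite -subr_eq0.
have := scaler_eq0 c (T v - v); rewrite (negPf c0) /= => <-.
by rewrite scalerBr -linearZ /= -cv poly_act_comm fixPhi subrr.
Qed.
End PolyAct.
End Prime.

(** * Reset words from extending words *)

Section ShortReset.
Variables (X : finType) (Sigma : {set {ffun X -> X}}).
Implicit Types (S : {set X}) (w : seq {ffun X -> X}).

Definition word_preim S w : {set X} := [set x | word_act x w \in S].

Lemma word_act_cat (x : X) w1 w2 :
  word_act x (w1 ++ w2) = word_act (word_act x w1) w2.
Proof. exact: foldl_cat. Qed.

Lemma word_over_cat w1 w2 :
  word_over Sigma (w1 ++ w2) = word_over Sigma w1 && word_over Sigma w2.
Proof. exact: all_cat. Qed.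

(** Extending S strictly takes at most |X| - |S| rounds to reach the full set. *)
Lemma word_preim_full m S :
    (forall S, S != set0 -> S != setT ->
      exists w, [/\ word_over Sigma w, size w <= m & #|S| < #|word_preim S w|]) ->
    S != set0 ->
  exists w, [/\ word_over Sigma w, size w <= m * (#|X| - #|S|)
              & word_preim S w = setT].
Proof.
move=> ext; have [k] := ubnP (#|X| - #|S|).
elim: k S => // k IHk S ltk S0.
have [->|ST] := eqVneq S setT.
  by exists [::]; split=> //; apply/setP=> x; rewrite !inE.
have [w [ww sw lt_w]] := ext S S0 ST.
have cSw : #|word_preim S w| <= #|X| := max_card _.
have [||w' [ww' sw' pw']] := IHk (word_preim S w).
- lia.
- by rewrite -card_gt0; lia.
exists (w' ++ w); split.
- by rewrite word_over_cat ww'.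
- rewrite size_cat; apply: leq_trans (leq_add sw' sw) _.
  by rewrite -mulnSr leq_mul2l; apply/orP; right; lia.
apply/setP=> x; have := congr1 (fun A : {set X} => x \in A) pw'.
by rewrite !inE word_act_cat.
Qed.

(** Words over injective letters act injectively, hence do not synchronize. *)
Lemma synchronizing_singular_letter :
    1 < #|X| -> synchronizing Sigma ->
  exists2 s : {ffun X -> X}, s \in Sigma & exists x y, x != y /\ s x = s y.
Proof.
move=> X1 [w [ww im1]].
have [/exists_inP[s sS /injectivePn[x [y xy sxy]]]|/exists_inPn inj] :=
  boolP [exists s in Sigma, ~~ injectiveb (s : {ffun X -> X})].
  by exists s => //; exists x, y.
suff injw : injective (fun x : X => word_act x w).
  by rewrite card_imset // in im1; rewrite im1 in X1.
elim: w ww {im1} => [|s w IHw] /= => [_ //|/andP[sS /IHw injw] x y /injw].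
exact: (injectiveP _ (negbNE (inj s sS))).
Qed.

(** The first extension, from one state to a fibre of a singular letter, costs
    one letter and leaves at most |X| - 2 rounds of cost |X|. *)
Lemma short_reset_word :
    1 < #|X| -> synchronizing Sigma ->
    (forall S, S != set0 -> S != setT ->
      exists w, [/\ word_over Sigma w, size w <= #|X| & #|S| < #|word_preim S w|]) ->
  exists2 w, synchronizing_word Sigma w & size w <= (#|X| - 1) ^ 2.
Proof.
move=> X1 syn ext; have [s sS [x [y [xy sxy]]]] := synchronizing_singular_letter X1 syn.
pose S := [set z | s z == s x].
have S2 : 1 < #|S|.
  have <- : #|[set x; y]| = 2 by rewrite cards2 xy.
  by apply: subset_leq_card; apply/subsetP=> z; rewrite !inE => /orP[]/eqP->; rewrite ?sxy.
have [|w [ww sw pw]] := word_preim_full (S := S) ext; first by rewrite -card_gt0; lia.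
exists (rcons w s); last first.
  rewrite size_rcons; have : #|X| * (#|X| - #|S|) <= #|X| * (#|X| - 2) by rewrite leq_mul2l; lia.
  by nia.
split; first by rewrite -cats1 word_over_cat ww /= sS.
have act z : word_act z (rcons w s) = s x.
  have := congr1 (fun A : {set X} => z \in A) pw.
  by rewrite !inE -cats1 word_act_cat => /eqP.
suff -> : [set word_act z (rcons w s) | z : X] = [set s x] by rewrite cards1.
apply/setP=> z; rewrite inE; apply/imsetP/eqP=> [[t _ ->]|->]; first exact: act.
by exists x; rewrite ?act.
Qed.
End ShortReset.

(** * Words acting on functions *)

Section Pullback.
Local Open Scope ring_scope.
Variables (X : finType) (Sigma : {set {ffun X -> X}}).
Implicit Types (S : {set X}) (w : seq {ffun X -> X}).
Local Notation V := {ffun X -> rat^o}.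
Implicit Types (f : V) (U W : {vspace V}).

Definition pullback_fun w f : V := [ffun x => f (word_act x w)].

Fact pullback_fun_is_linear w : linear (pullback_fun w).
Proof. by move=> c f g; apply/ffunP=> x; rewrite !ffunE. Qed.
HB.instance Definition _ w :=
  GRing.isLinear.Build rat V V _ (pullback_fun w) (pullback_fun_is_linear w).

(** The bundled form of the linear map, which takes images of subspaces. *)
Definition pullback w : 'End(V) := linfun (pullback_fun w).

Lemma pullbackE w f x : pullback w f x = f (word_act x w).
Proof. by rewrite lfunE ffunE. Qed.

Lemma pullback_cat w1 w2 f : pullback (w1 ++ w2) f = pullback w1 (pullback w2 f).
Proof. by apply/ffunP=> x; rewrite !pullbackE word_act_cat. Qed.

Lemma dim_ffun_rat : \dim {:V} = #|X|.
Proof. by rewrite dimvf /dim /= muln1. Qed.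

(** As long as U lies in W and is not stable under all letters, adding the image
    of U under a letter raises the dimension.  A stable U inside W would keep
    all the pullbacks of f in W. *)
Lemma pullback_escape U W f w :
    f \in U -> word_over Sigma w -> pullback w f \notin W ->
  exists u, [/\ word_over Sigma u, (size u + \dim U <= #|X|)%N
              & ~~ (pullback u @: U <= W)%VS].
Proof.
move=> fU ww wf; have [k] := ubnP (#|X| - \dim U).
elim: k U fU => // k IHk U fU ltk.
have [UW|nUW] := boolP (pullback [::] @: U <= W)%VS; last first.
  by exists [::]; split=> //; rewrite add0n -dim_ffun_rat dimvS ?subvf.
have [/exists_inP[s sS nUs]|/exists_inPn stab] :=
    boolP [exists s in Sigma, ~~ (pullback [:: s] @: U <= U)%VS].
  pose U' := (U + pullback [:: s] @: U)%VS.
  have UU' : (U <= U')%VS by apply: addvSl.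
  have dimUU' : (\dim U < \dim U')%N.
    rewrite ltnNge; apply: contra nUs => le.
    have /eqP eqU : U == U' by rewrite eqEdim UU'.
    by rewrite {2}eqU addvSr.
  have dimU' : (\dim U' <= #|X|)%N by rewrite -dim_ffun_rat dimvS ?subvf.
  have [||u [wu su nu]] := IHk U'; [exact: subvP fU | lia |].
  have [nuU|uU] := boolP (pullback u @: U <= W)%VS; last first.
    by exists u; split=> //; lia.
  (* The word u moves U' out of W but keeps U inside, so it moves out the image
     of U under s. *)
  exists (rcons u s); rewrite size_rcons; split; [|lia|].
    by rewrite -cats1 word_over_cat wu /= sS.
  apply: contra nu => uU; rewrite limgD subv_add nuU.
  apply/subvP=> _ /memv_imgP[_ /memv_imgP[g gU ->] ->].
  rewrite -pullback_cat cats1; apply: (subvP uU); exact: memv_img.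
case/negP: wf; rewrite -[w]cat0s pullback_cat; apply: (subvP UW); apply: memv_img.
elim: w ww => [|s w IHw] /=.
  by move=> _; suff -> : pullback [::] f = f by []; apply/ffunP=> x; rewrite pullbackE.
case/andP=> sS /IHw wU; rewrite -[s :: w]cat1s pullback_cat.
by apply: (subvP (negbNE (stab s sS))); apply: memv_img.
Qed.

Definition total f : rat^o := \sum_x f x.

Fact total_is_linear : linear total.
Proof.
move=> c f g; rewrite /total scaler_sumr -big_split.
by apply: eq_bigr => x _; rewrite !ffunE.
Qed.
HB.instance Definition _ := GRing.isLinear.Build rat V rat^o _ total total_is_linear.

(** Scaling by |X| keeps the values integral and makes the total vanish. *)
Definition centered_indicator S : V :=
  [ffun x => #|X|%:R * (x \in S)%:R - #|S|%:R].

Lemma total_pullback_centered S w :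
  total (pullback w (centered_indicator S)) =
  #|X|%:R * (#|word_preim S w|%:R - #|S|%:R).
Proof.
pose F x : rat := #|X|%:R * (x \in word_preim S w)%:R - #|S|%:R.
rewrite /total (eq_bigr F); last first.
  by move=> x _; rewrite /F pullbackE ffunE inE.
rewrite sumrB -mulr_sumr mulrBr sumr_const cardT -cardE !mulr_natl.
congr (_ *+ _ - _).
by rewrite -sum1_card natr_sum [RHS]big_mkcond /=; apply: eq_bigr => x _; case: ifP.
Qed.

Lemma total_pullback_gt0 S w :
  0 < total (pullback w (centered_indicator S)) -> (#|S| < #|word_preim S w|)%N.
Proof.
rewrite total_pullback_centered => tot; rewrite -(ltr_nat rat) -subr_gt0.
rewrite -(pmulr_rgt0 _ _ (x := #|X|%:R)) // ltr0n lt0n; apply: contraTneq tot => ->.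
by rewrite mul0r ltxx.
Qed.

Lemma centered_indicator_neq0 S :
  S != set0 -> S != setT -> centered_indicator S != 0.
Proof.
case/set0Pn=> x xS; apply: contraNneq => gamma0; rewrite eqEcard subsetT -(ler_nat rat).
have := congr1 (fun f : V => f x) gamma0; rewrite !ffunE xS mulr1 cardsT.
move=> XS; have -> : #|X|%:R = #|S|%:R :> rat by apply: subr0_eq.
by rewrite lexx.
Qed.

(** Along the word u given by [pullback_escape], the pullbacks of the F i do not
    all have total 0.  Their totals add up to 0, so one of them is positive, and
    the lengths of u and of the word producing F i add up to at most |X|. *)
Lemma extension_by_averaging S (I : finType) (P : {set I}) (F : I -> V) i0 :
    synchronizing Sigma -> S != set0 -> S != setT ->
    i0 \in P -> F i0 = centered_indicator S -> \sum_(i in P) F i = 0 ->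
    (forall i, i \in P -> exists w, [/\ word_over Sigma w,
        (size w <= \dim (\sum_(j in P) <[F j]>))%N &
        pullback w (centered_indicator S) = F i]) ->
  exists w, [/\ word_over Sigma w, (size w <= #|X|)%N & (#|S| < #|word_preim S w|)%N].
Proof.
move=> [w0 [ww0 im1]] S0 ST i0P Fi0 sumF words.
set U := (\sum_(j in P) <[F j]>)%VS in words *.
have FU i : i \in P -> F i \in U.
  by move=> iP; apply: subvP (sumv_sup i iP (subvv _)) _ (memv_line _).
(* A reset word takes every state to the same c, and the centred indicator
   does not vanish at c. *)
have tot0 : total (pullback w0 (centered_indicator S)) != 0.
  rewrite total_pullback_centered mulf_neq0 //.
    by rewrite pnatr_eq0 -lt0n; have /set0Pn[x _] := S0; apply/card_gt0P; exists x.
  rewrite subr_eq0 eqr_nat; have /eqP/cards1P[c im_c] := im1.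
  have act x : word_act x w0 = c.
    by apply/set1P; rewrite -im_c; apply: imset_f.
  have [cS|cS] := boolP (c \in S).
    have -> : word_preim S w0 = setT by apply/setP=> x; rewrite !inE act.
    by apply: contra ST => /eqP cardS; rewrite eqEcard subsetT cardS /=.
  have -> : word_preim S w0 = set0 by apply/setP=> x; rewrite !inE act (negPf cS).
  by rewrite cards0 eq_sym cards_eq0.
have notW : pullback w0 (F i0) \notin lker (linfun total).
  by rewrite Fi0 memv_ker lfunE.
have [u [wu su nU]] := pullback_escape (FU i0 i0P) ww0 notW.
have [/exists_inP[i iP totu]|/exists_inPn neg] :=
    boolP [exists i in P, 0 < total (pullback u (F i))].
  have [v [wv sv Fv]] := words i iP.
  exists (u ++ v); split.
  - by rewrite word_over_cat wu.
  - by rewrite size_cat; apply: leq_trans su; rewrite leq_add2l.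
  - by apply: total_pullback_gt0; rewrite pullback_cat Fv.
case/negP: nU; rewrite limg_sum; apply/subv_sumP=> i iP.
rewrite limg_line -memvE memv_ker lfunE /=; apply/eqP.
have sum0 : \sum_(i in P) - total (pullback u (F i)) = 0.
  by rewrite sumrN -!linear_sum /= sumF !raddf0.
apply/eqP; rewrite -oppr_eq0; apply/eqP; move: i iP; apply: (psumr_eq0P _ sum0) => i iP.
by rewrite oppr_ge0 leNgt neg.
Qed.
End Pullback.

(** * Lengths in dihedral groups *)

Section Dihedral.
Local Open Scope group_scope.
Variables (gT : finGroupType).
Implicit Types (Delta : {set gT}) (ds : seq gT).

Definition product_le Delta k g :=
  exists ds, [/\ all (fun d => d \in Delta) ds, size ds <= k & \prod_(d <- ds) d = g].

Lemma product_le1 Delta d : d \in Delta -> product_le Delta 1 d.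
Proof. by exists [:: d]; rewrite /= H big_seq1. Qed.

Lemma product_leM Delta k l g h :
  product_le Delta k g -> product_le Delta l h -> product_le Delta (k + l) (g * h).
Proof.
move=> [ds [Dds sds <-]] [es [Des ses <-]]; exists (ds ++ es).
by rewrite all_cat Dds size_cat leq_add // big_cat.
Qed.

Lemma product_leX Delta k g i :
  product_le Delta k g -> product_le Delta (i * k) (g ^+ i).
Proof.
move=> gk; elim: i => [|i IHi]; first by exists [::]; rewrite big_nil.
by rewrite mulSn expgS; apply: product_leM.
Qed.

Lemma product_leW Delta k l g : k <= l -> product_le Delta k g -> product_le Delta l g.
Proof. by move=> kl [ds [Dds sds <-]]; exists ds; rewrite (leq_trans sds). Qed.

Lemma word_act_product (x : gT) ds :
  word_act x (map (@right_translation gT) ds) = x * \prod_(d <- ds) d.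
Proof.
elim: ds x => [|d ds IHds] x /=; first by rewrite big_nil mulg1.
by rewrite [LHS]IHds ffunE big_cons mulgA.
Qed.

(** What is used of the dihedral group: a rotation r of order p and index 2, all
    elements outside <[r]> being involutions. *)
Lemma dihedral_rotation p :
    prime p -> [set: gT] \isog 'D_(2 * p) ->
  exists r : gT, [/\ #[r] = p, #|gT| = (2 * p)%N & forall g, g \notin <[r]> -> g * g = 1].
Proof.
move=> p_pr iso; have p1 := prime_gt1 p_pr; have cG : #|gT| = (2 * p)%N.
  by rewrite -cardsT (card_isog iso) mul2n card_dihedral.
have : [set: gT] \homg Grp (x : y : x ^+ p, y ^+ 2, x ^ y = x^-1).
  by rewrite -(Grp_dihedral p1) -mul2n isog_hom.
case/existsP=> -[r s] /=; rewrite !xpair_eqE => /and4P[/eqP defG /eqP rp /eqP s2 /eqP rs].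
exists r.
have nrs : <[s]> \subset 'N(<[r]>) by rewrite norms_cycle rs groupV cycle_id.
rewrite norm_joinEr // in defG.
have os : #[s] <= 2 by rewrite dvdn_leq // order_dvdn s2.
have le_rp : #[r] <= p by rewrite dvdn_leq ?prime_gt0 // order_dvdn rp.
have := mul_cardG <[r]> <[s]>; rewrite defG cardsT cG -!orderE => card.
(* The relations bound #[r] and #[s] from above; the order 2 p of the group
   forces equality. *)
have rp' : #[r] = p.
  apply/eqP; rewrite eqn_leq le_rp /= -(leq_pmul2l (isT : 0 < 2)).
  apply: leq_trans (leq_mul os (leqnn _)); rewrite mulnC in card.
  by rewrite card leq_pmulr.
split=> // g gr; have : g \in [set: gT] by [].
rewrite -defG => /mulsgP[_ _ /cycleP[i ->] /cycleP[j ->] Dg].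
have : odd j.
  apply: contraR gr => ej; rewrite Dg -(odd_double_half j) (negPf ej) add0n -mul2n expgM s2.
  by rewrite expg1n mulg1 mem_cycle.
move=> oj; have sj : s ^+ j = s.
  by rewrite -(odd_double_half j) oj expgD -mul2n expgM s2 expg1n mulg1.
have ss : s * s = 1 by rewrite -[RHS]s2.
have ri : s * r ^+ i = r ^- i * s.
  have sV : s^-1 = s by rewrite -[LHS]mulg1 -ss mulKg.
  by rewrite -expgVn -rs -conjXg conjgE sV -!mulgA ss mulg1.
by rewrite Dg sj mulgA -(mulgA _ s) ri mulKVg ss.
Qed.

Section Lengths.
Variables (p : nat) (r : gT) (Delta : {set gT}).
Hypotheses (p_pr : prime p) (p_odd : odd p) (ord_r : #[r] = p) (cG : #|gT| = (2 * p)%N).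
Hypothesis invol : forall g, g \notin <[r]> -> g * g = 1.
Hypothesis gen : <<Delta>> = [set: gT].

Lemma mul_notin_rotations g h : g \notin <[r]> -> h \notin <[r]> -> g * h \in <[r]>.
Proof.
move=> gr hr; have ir : #|[set: gT] : <[r]>| = 2.
  by rewrite -divgS ?subsetT // cardsT cG -orderE ord_r mulnK ?prime_gt0.
have : g \in <[r]> :* h by rewrite (rcoset_index2 (subsetT _) ir) inE ?gr ?hr ?inE.
by case/rcosetP=> c cr ->; rewrite -mulgA invol ?mulg1.
Qed.

Lemma generator_notin_rotations : exists2 a, a \in Delta & a \notin <[r]>.
Proof.
apply/subsetPn; rewrite -gen_subG gen; apply/negP=> /subset_leq_card.
by rewrite cardsT cG -orderE ord_r mul2n -addnn leqNgt -[X in X < _]add0n ltn_add2r prime_gt0.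
Qed.

Lemma rotation_expg d c :
  d \in <[r]> -> d != 1 -> c \in <[r]> -> exists2 i, i < p & c = d ^+ i.
Proof.
move=> dr d1; have od : #[d] = p.
  have := order_dvdG dr; rewrite -orderE ord_r => dvd_p; apply/eqP.
  by have [_ /(_ _ dvd_p)] := primeP p_pr; rewrite order_eq1 (negPf d1).
have -> : <[r]> = <[d]>.
  by apply/esym/eqP; rewrite eqEcard cycle_subG dr -!orderE od ord_r /=.
by case/cyclePmin=> i; rewrite od; exists i.
Qed.

(** If a generator d is a nontrivial rotation, its powers suffice.  Otherwise
    there are two distinct reflections a and b among the generators, and a
    rotation is (a b)^i = (b a)^(p - i) for some i < p.  As p is odd, one of the
    lengths 2 i and 2 (p - i) is at most p - 1. *)
Lemma rotation_product_le c : c \in <[r]> -> product_le Delta p.-1 c.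
Proof.
have p1 := prime_gt1 p_pr.
move=> cr; have [/exists_inP[d dD /andP[dr d1]]|/exists_inPn noD] :=
    boolP [exists d in Delta, (d \in <[r]>) && (d != 1)].
  have [i ltip ->] := rotation_expg dr d1 cr.
  by apply: product_leW (product_leX i (product_le1 dD)); lia.
have [a aD ar] := generator_notin_rotations.
have [b bD ba] : exists2 b, b \in Delta & b \notin [set 1; a].
  (* Generators inside {1, a} would generate a group of order at most 2. *)
  apply/subsetPn; apply: contraTN isT => D1a.
  have /subset_leq_card : [set: gT] \subset <[a]>.
    by rewrite -gen gen_subG (subset_trans D1a) // subUset !sub1set group1 cycle_id.
  have oa : #[a] <= 2 by rewrite dvdn_leq // order_dvdn expgS invol.
  by rewrite cardsT cG -orderE; lia.
move: ba; rewrite !inE negb_or => /andP[b1 ba].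
have br : b \notin <[r]> by have := noD b bD; rewrite b1 andbT.
have abr := mul_notin_rotations ar br.
have ab1 : a * b != 1.
  by apply: contraNneq ba => ab1; rewrite -(mulgI _ _ _ (etrans ab1 (esym (invol ar)))).
have [i ltip ->] := rotation_expg abr ab1 cr.
have ab2 := product_leM (product_le1 aD) (product_le1 bD).
have ba2 := product_leM (product_le1 bD) (product_le1 aD).
have [le_i|lt_i] := leqP i.*2 p.-1.
  by apply: product_leW (product_leX i ab2); lia.
have -> : (a * b) ^+ i = (b * a) ^+ (p - i).
  have baab : (b * a) = (a * b)^-1.
    by apply/eqP; rewrite eq_sym eq_invg_mul -mulgA (mulgA b) invol // mul1g invol.
  rewrite baab expgVn; apply/eqP; rewrite eq_sym eq_invg_mul -expgD subnK ?(ltnW ltip) //.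
  by rewrite -ord_r orderE -order_dvdn order_dvdG.
apply: product_leW (product_leX (p - i) ba2).
have := odd_double_half p; rewrite p_odd; lia.
Qed.

Lemma product_le_full g : product_le Delta p g.
Proof.
have p0 := prime_gt0 p_pr.
have [gr|gr] := boolP (g \in <[r]>).
  by apply: product_leW (rotation_product_le gr); exact: leq_pred.
have [a aD ar] := generator_notin_rotations.
(* A reflection g is the rotation g a followed by the generator a. *)
rewrite -[g]mulg1 -(invol ar) mulgA -(prednK p0) -addn1.
apply: product_leM (product_le1 aD); apply: rotation_product_le.
exact: mul_notin_rotations.
Qed.

End Lengths.
End Dihedral.

(** * Extending sets of states of a dihedral Cayley graph *)

Section DihedralExtension.
Local Open Scope ring_scope.
Variables (gT : finGroupType) (p : nat) (r : gT).
Variables (Delta : {set gT}) (Sigma : {set {ffun gT -> gT}}) (S : {set gT}).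
Hypotheses (p_pr : prime p) (p_odd : odd p).
Hypotheses (ord_r : #[r]%g = p) (cG : #|gT| = (2 * p)%N).
Hypothesis invol : forall g, g \notin <[r]>%g -> (g * g = 1)%g.
Hypothesis gen : (<<Delta>> = [set: gT])%g.
Hypothesis sDS : cayley_graph Delta \subset Sigma.
Hypotheses (syn : synchronizing Sigma) (S0 : S != set0) (ST : S != setT).

Local Notation gamma := (centered_indicator S).
Local Notation T g := (pullback [:: right_translation g]).

Lemma translateE (g : gT) (f : {ffun gT -> rat^o}) x : T g f x = f (x * g)%g.
Proof. by rewrite pullbackE /= ffunE. Qed.

Lemma translate1 (f : {ffun gT -> rat^o}) : T 1%g f = f.
Proof. by apply/ffunP=> x; rewrite translateE mulg1. Qed.

Lemma translateM g h (f : {ffun gT -> rat^o}) : T (g * h)%g f = T g (T h f).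
Proof. by apply/ffunP=> x; rewrite !translateE mulgA. Qed.

Lemma iter_translate i (f : {ffun gT -> rat^o}) : iter i (T r) f = T (r ^+ i)%g f.
Proof.
elim: i => [|i IHi] /=; first by rewrite expg0 translate1.
by rewrite IHi expgS translateM.
Qed.

Lemma sum_cycle (M : nmodType) (F : gT -> M) :
  \sum_(c in <[r]>%g) F c = \sum_(i < #[r]%g) F (r ^+ i)%g.
Proof.
have -> : <[r]>%g = [set (r ^+ i)%g | i : 'I_#[r]%g].
  apply/setP=> c; apply/idP/imsetP=> [/cyclePmin[i lti ->]|[i _ ->]]; last exact: mem_cycle.
  by exists (Ordinal lti).
rewrite big_imset //= => i j _ _ /eqP; rewrite eq_expg_mod_order !modn_small //.
by move=> /eqP ij; apply: val_inj.
Qed.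

Lemma product_le_word k g :
    product_le Delta k g ->
  exists w, [/\ word_over Sigma w, (size w <= k)%N & pullback w gamma = T g gamma].
Proof.
move=> [ds [Dds sds <-]]; exists (map (@right_translation gT) ds).
split; [|by rewrite size_map|].
  rewrite /word_over all_map; apply: sub_all Dds => d dD /=.
  by apply: (subsetP sDS); apply: imset_f.
by apply/ffunP=> x; rewrite pullbackE word_act_product translateE.
Qed.

(** At each point the sum is the total of gamma. *)
Lemma sum_translate : \sum_(g in [set: gT]) T g gamma = 0.
Proof.
have tot0 : total gamma = 0.
  suff -> : gamma = pullback [::] gamma.
    rewrite total_pullback_centered; suff -> : word_preim S [::] = S by rewrite subrr mulr0.
    by apply/setP=> y; rewrite inE.
  by apply/ffunP=> y; rewrite pullbackE.
apply/ffunP=> x; rewrite sum_ffunE [RHS]ffunE -[RHS]tot0.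
rewrite /total [RHS](reindex_inj (mulgI x)) /=.
by apply: eq_big => [g|g _]; rewrite ?inE ?translateE.
Qed.

Lemma dim_translates m :
    T r gamma != gamma -> (m <= p)%N ->
    (m = p -> \sum_(c in <[r]>%g) T c gamma != 0) ->
  (m <= \dim (\sum_(c in <[r]>%g) <[T c gamma]>))%N.
Proof.
move=> Tr lemp nz.
have Tp : iter p (T r) gamma = gamma.
  by rewrite iter_translate -ord_r expg_order translate1.
have : free [tuple iter i (T r) gamma | i < m].
  apply: (@free_iter_prime_order _ _ p) => // /nz; congr (_ != 0).
  rewrite sum_cycle ord_r; apply: eq_bigr => i _.
  by rewrite iter_translate.
rewrite /free size_tuple => /eqP <-; apply/dimvS/span_subvP=> _ /mapP[i _ ->].
rewrite iter_translate memvE.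
by apply: (sumv_sup (r ^+ i)%g); rewrite ?mem_cycle.
Qed.

Lemma dihedral_extension :
  exists w, [/\ word_over Sigma w, (size w <= #|gT|)%N & (#|S| < #|word_preim S w|)%N].
Proof.
have p1 := prime_gt1 p_pr.
have [a aD ar] := generator_notin_rotations p_pr ord_r cG gen.
have [Tr|Tr] := eqVneq (T r gamma) gamma.
  have Trot c : c \in <[r]>%g -> T c gamma = gamma.
    by case/cycleP=> i ->; rewrite -iter_translate; elim: i => //= i ->.
  apply: (@extension_by_averaging _ _ _ _ [set 1%g; a] (fun g => T g gamma) 1%g) => //.
  - by rewrite !inE eqxx.
  - exact: translate1.
  - (* Each coset of <[r]> contributes p equal translates to the sum of all
       translates, so p (gamma + T a gamma) = 0. *)
    have a1 : a != 1%g by apply: contraNneq ar => ->; apply: group1.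
    rewrite big_setU1 ?inE 1?eq_sym //= big_set1 translate1.
    have := sum_translate; rewrite (bigID (mem <[r]>%g)) /=.
    rewrite (eq_bigl (mem <[r]>%g)) => [|c]; last by rewrite inE.
    rewrite (eq_bigr (fun=> gamma)) => [|c]; last exact: Trot.
    rewrite [X in _ + X](reindex_inj (mulgI a)) /=.
    rewrite [X in _ + X](eq_bigl (mem <[r]>%g)) => [|c]; last first.
      rewrite inE /=; have [cr|cr] := boolP (c \in <[r]>%g); first by rewrite groupMr.
      by rewrite (mul_notin_rotations p_pr ord_r cG invol).
    rewrite [X in _ + X](eq_bigr (fun=> T a gamma)) => [|c cr]; last first.
      by rewrite translateM Trot.
    rewrite !sumr_const -mulrnDl -orderE ord_r -scaler_nat => /eqP.
    by rewrite scaler_eq0 pnatr_eq0 (gtn_eqF (prime_gt0 p_pr)) /= => /eqP.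
  move=> g; rewrite !inE => Pg; apply: product_le_word.
  (* The span is nonzero, and the words for 1 and a have at most one letter. *)
  apply: (@product_leW _ _ 1).
    rewrite -[1%N]/(nat_of_bool true) -(centered_indicator_neq0 S0 ST) -dim_vline.
    by apply/dimvS/(sumv_sup 1%g); rewrite ?inE ?eqxx // translate1.
  case/orP: Pg => /eqP ->; last exact: product_le1.
  by exists [::]; rewrite big_nil.
have [sum0|sum_neq0] := eqVneq (\sum_(c in <[r]>%g) T c gamma) 0.
  apply: (@extension_by_averaging _ _ _ _ <[r]>%g (fun g => T g gamma) 1%g) => //.
    exact: translate1.
  move=> c cr; apply: product_le_word.
  apply: product_leW (rotation_product_le p_pr p_odd ord_r cG invol gen cr).
  apply: dim_translates => // [|pp]; first exact: leq_pred.
  by exfalso; lia.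
apply: (@extension_by_averaging _ _ _ _ setT (fun g => T g gamma) 1%g) => //.
- exact: translate1.
- exact: sum_translate.
move=> g _; apply: product_le_word.
apply: product_leW (product_le_full p_pr p_odd ord_r cG invol gen g).
apply: leq_trans (dim_translates Tr (leqnn p) _) _ => //.
apply: dimvS; apply/subv_sumP=> c cr.
exact: sumv_sup (in_setT c) (subvv _).
Qed.

End DihedralExtension.

Theorem theorem5p8 (p : nat) (hp : prime p) (hodd : odd p)
    (gT : finGroupType) (hD : ([set: gT] \isog 'D_(2 * p))%g) :
  cerny_group gT.
Proof.
have [r [ord_r cG invol]] := dihedral_rotation hp hD.
move=> Delta gen Sigma sDS syn; apply: short_reset_word => //.
  by rewrite cG; have := prime_gt1 hp; lia.
by move=> S S0 ST; apply: (dihedral_extension hp hodd ord_r cG invol gen sDS syn S0 ST).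
Qed.
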